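(* Let $\mathcal{F}$ be an SML FSM class with $n$ states and a finite set of child classes, where child class $t$ has $n_t$ states. Suppose that for some children configuration $c$ (with at least one child of each child class) there is a loop of \texttt{move\_to} actions $s_0\to s_1\to\dots\to s_m=s_0$ ($m\ge 1$) of $\mathcal{F}$ under $c$. Then there exist a children configuration $c'$ having exactly $n_t$ children of class $t$ for every child class $t$, and an integer $\ell$ with $1\le \ell\le n$, such that in the Kripke structure $\mathcal{M}$ there is a path of length $\ell$ from $(s_0,c')$ back to $(s_0,c')$ whose $\mathcal{F}$-components are exactly the states among $s_0,\dots,s_{m-1}$ (i.e. the loop is found by considering paths of length at most $n$ in a configuration with $n_t$ children of each class $t$).
   Context: An SML FSM class has a finite set $S$ of states ($|S|=n$). Each state $s\in S$ carries an ordered list of when clauses $(G_1,s_1),\dots,(G_m,s_m)$ with $s_i\in S$, where each guard $G_i$ is a Boolean combination of atomic conditions ''$\mathrm{ANY}\ P$ in\_state $T$'' or ''$\mathrm{ALL}\ P$ in\_state $T$'', with $P$ a child class or the literal FwCHILDREN (all children regardless of class) and $T$ a set of states; ''ANY $P$ in\_state $T$'' holds iff some child matching $P$ is in a state of $T$, ''ALL $P$ in\_state $T$'' holds iff every child matching $P$ is in a state of $T$. A children configuration consists of a finite collection of children, each with a child class $t$ and a current state among the $n_t$ states of class $t$. Under a fixed configuration $c$ (children states do not change during the when phase), $\mathcal{F}$ in state $s$ performs a \texttt{move\_to} action to $s_i$ where $i$ is the smallest index with $G_i$ true under $c$; if no guard is true, no \texttt{move\_to} is performed. A loop of \texttt{move\_to}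 actions is a nonempty sequence of such actions under a single configuration starting and ending in the same state. The Kripke structure $\mathcal{M}$ has states $(s,c)$ ($s\in S$, $c$ a configuration), all of which are initial, and a transition $(s,c)\to(s',c)$ iff $\mathcal{F}$ in state $s$ under $c$ does a \texttt{move\_to} to $s'$. *)

(* Defs.v *)
From HB Require Import structures.
From mathcomp Require Import all_boot.

Set Implicit Arguments.
Unset Strict Implicit.
Unset Printing Implicit Defensive.

(* States of children are identified by name, and different child classes may
   share state names: this is what makes "FwCHILDREN in_state T" meaningful
   across classes.  The number n_t of states of class t is #|class_states t|.
   Pairwise disjoint state sets are a special case. *)
Record child_sig := ChildSig {
  child_class : finType;
  state_name : finType;
  class_states : child_class -> {set state_name}
}.

Definition child (sg : child_sig) : Type :=
  {x : child_class sg * state_name sg | x.2 \in class_states x.1}.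

Definition class_of (sg : child_sig) (x : child sg) : child_class sg :=
  (val x).1.

Definition state_of (sg : child_sig) (x : child sg) : state_name sg :=
  (val x).2.

(* The children are individuals, told apart by their position: several of them
   may have the same class and the same current state. *)
Definition config (sg : child_sig) : Type := seq (child sg).

Definition nchildren (sg : child_sig) (c : config sg) (t : child_class sg) :=
  count (fun x : child sg => class_of x == t) c.

Inductive child_pattern (sg : child_sig) :=
| PClass of child_class sg
| FwCHILDREN.

Arguments FwCHILDREN {sg}.

Definition matches (sg : child_sig) (P : child_pattern sg) (x : child sg) :=
  match P with
  | PClass t => class_of x == t
  | FwCHILDREN => true
  end.

Inductive guard (sg : child_sig) :=
| GAny of child_pattern sg & {set state_name sg}
| GAll of child_pattern sg & {set state_name sg}
| GNot of guard sg
| GAnd of guard sg & guard sg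
| GOr of guard sg & guard sg.

Fixpoint holds (sg : child_sig) (c : config sg) (G : guard sg) : bool :=
  match G with
  | GAny P T => has (fun x : child sg => matches P x && (state_of x \in T)) c
  | GAll P T => all (fun x : child sg => matches P x ==> (state_of x \in T)) c
  | GNot G1 => ~~ holds c G1
  | GAnd G1 G2 => holds c G1 && holds c G2
  | GOr G1 G2 => holds c G1 || holds c G2
  end.

Record fsm_class (sg : child_sig) := FsmClass {
  fsm_state : finType;
  when_clauses : fsm_state -> seq (guard sg * fsm_state)
}.

(* [find] returns the smallest index of a true guard, and the length of the
   list (where [onth] is [None]) when there is none. *)
Definition move_to (sg : child_sig) (F : fsm_class sg) (c : config sg)
    (s : fsm_state F) : option (fsm_state F) :=
  let w := when_clauses s in
  omap snd (onth w (find (fun cl => holds c cl.1) w)).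

Definition does_move_to (sg : child_sig) (F : fsm_class sg) (c : config sg) :
    rel (fsm_state F) :=
  fun s s' => move_to c s == Some s'.

(* The loop s_0 -> s_1 -> ... -> s_m = s_0 is given by s_0 and
   p = [:: s_1; ...; s_m], so that belast s_0 p = [:: s_0; ...; s_(m-1)]. *)
Definition move_to_loop (sg : child_sig) (F : fsm_class sg) (c : config sg)
    (s0 : fsm_state F) (p : seq (fsm_state F)) : Prop :=
  [/\ 0 < size p, path (@does_move_to sg F c) s0 p & last s0 p = s0].

Record kripke (T : Type) := Kripke {
  kinit : pred T;
  ktrans : rel T
}.

Definition kripke_of (sg : child_sig) (F : fsm_class sg) :
    kripke (fsm_state F * config sg) :=
  {| kinit := fun=> true;
     ktrans := fun x y => (y.2 == x.2) && does_move_to x.2 x.1 y.1 |}.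

(* Main.v *)
Require Import Defs.
From HB Require Import structures.
From mathcomp Require Import all_boot.

Set Implicit Arguments.
Unset Strict Implicit.
Unset Printing Implicit Defensive.

(** ANY and ALL only see which (class, state) pairs are inhabited, not how
    often.  So the children of class [t] may be replaced by one child in each
    of the at most [n_t] inhabited states, one of them being repeated to reach
    [n_t] children; every guard keeps its truth value.  As [move_to] is a
    partial function of the current state, a closed walk runs around a single
    simple cycle, whose length is at most [n]. *)

(** The vertices of the walk form the orbit of [x] under the successor function, and an orbit,
    listed without repetition, has at most [#|T|] elements. *)
Lemma functional_closed_walk_cycle (T : finType) (e : rel T) (x : T)
    (p : seq T) :
    (forall y z z', e y z -> e y z' -> z = z') ->
    0 < size p -> path e x p -> last x p = x ->
  exists q : seq T,
    [/\ 0 < size q <= #|T|, path e x q, last x q = x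
      & belast x q =i belast x p].
Proof.
move=> e_fun; case/lastP: p => // b y _; rewrite last_rcons => + yx.
(* The default [y] is harmless: every vertex of the walk has an [e]-successor. *)
rewrite {y}yx belast_rcons => cycle_b; pose f y := odflt y [pick z | e y z].
have fE y z : e y z -> f y = z.
  by move=> yz; rewrite /f; case: pickP => [z' /e_fun/(_ yz)|/(_ z)/[!yz]].
have fcycle_b : fcycle f (x :: b).
  apply: (sub_cycle (e := e)); last exact: cycle_b.
  by move=> y z /fE /= ->.
have orbitE : orbit f x =i x :: b.
  by move=> y; rewrite -(undup_cycle_cons fcycle_b) mem_undup.
have : cycle e (orbit f x).
  (* An [f]-step is an [e]-step only where a successor exists, so the inclusion is restricted to the
     walk, where [next] supplies one. *)
  apply: (@sub_in_cycle _ (mem (x :: b)) (frel f)).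
  - move=> y z by_ _ /= /eqP <-.
    by have /= yz := next_cycle (p := x :: b) cycle_b by_; rewrite (fE _ _ yz).
  - by apply/allP => y; rewrite orbitE.
  - by apply: (cycle_orbit_cycle fcycle_b); rewrite mem_head.
have := max_card (mem (orbit f x)).
rewrite (card_uniqP (orbit_uniq f x)) size_orbit.
(* Splitting [x] off the orbit leaves [o]; closing up with a final [x] restores the length to the
   order of [x]. *)
move: orbitE; rewrite /orbit -orderSpred /= => orbitE size_le cycle_f.
set o := traject f (f x) _ in orbitE cycle_f.
exists (rcons o x); split; rewrite ?last_rcons ?belast_rcons //.
by rewrite size_rcons size_traject.
Qed.

Lemma exists_seq_eq_mem_size (T : eqType) (s : seq T) (m : nat) :
  0 < size s <= m -> exists2 s' : seq T, size s' = m & s' =i s.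
Proof.
(* Pad with copies of the head, which exists as [s] is nonempty. *)
case: s => // x s /= size_le; exists (ncons (m - (size s).+1) x (x :: s)).
  by rewrite size_ncons subnK.
move=> y; rewrite -cat_nseq mem_cat mem_nseq inE.
by case: eqP; rewrite ?andbF ?orbT.
Qed.

Lemma eq_mem_holds (sg : child_sig) (c c' : config sg) :
  c =i c' -> holds c =1 holds c'.
Proof.
move=> eq_cc'; elim=> //= [P T|P T|G ->|G1 -> G2 ->|G1 -> G2 ->] //.
  exact: eq_has_r.
exact: eq_all_r.
Qed.

Lemma eq_mem_move_to (sg : child_sig) (F : fsm_class sg) (c c' : config sg) :
  c =i c' -> move_to (F := F) c =1 move_to c'.
Proof.
move=> /eq_mem_holds eq_holds s; rewrite /move_to.
by under eq_find => cl do rewrite eq_holds.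
Qed.

(** Within one class a child is determined by its state, so [state_of] is injective on [s]. *)
Lemma uniq_class_size (sg : child_sig) (t : child_class sg)
    (s : config sg) :
  uniq s -> all (fun x => class_of x == t) s -> size s <= #|class_states t|.
Proof.
move=> s_uniq /allP s_t; rewrite -(size_map (@state_of sg)).
have /card_uniqP <- : uniq (map (@state_of sg) s).
  rewrite map_inj_in_uniq // => x y /s_t/eqP xt /s_t/eqP yt eq_xy.
  apply: val_inj; rewrite [LHS]surjective_pairing [RHS]surjective_pairing.
  by congr pair; rewrite // [LHS]xt.
apply: subset_leq_card; apply/subsetP => _ /mapP [x /s_t/eqP <- ->].
exact: valP x.
Qed.

Lemma exists_eq_mem_config (sg : child_sig) (c : config sg) :
    (forall t : child_class sg, 0 < nchildren c t) ->
  exists2 c' : config sg,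
    forall t : child_class sg, nchildren c' t = #|class_states t| & c' =i c.
Proof.
move=> c_pop; pose ct t := [seq x <- c | class_of x == t].
have /fin_all_exists2 [g g_size g_mem] t :
    exists2 s, size s = #|class_states t| & s =i ct t.
  have /exists_seq_eq_mem_size [s s_size s_mem] :
      0 < size (undup (ct t)) <= #|class_states t|.
    apply/andP; split; last first.
      apply: uniq_class_size; first exact: undup_uniq.
      by apply/allP => x; rewrite mem_undup mem_filter => /andP [].
    rewrite -has_predT (eq_has_r (mem_undup _)) has_predT.
    by rewrite size_filter; apply: c_pop.
  by exists s => // x; rewrite s_mem mem_undup.
have g_class t x : x \in g t -> class_of x = t.
  by rewrite g_mem mem_filter => /andP [/eqP].
exists (flatten [seq g t | t <- enum (child_class sg)]) => [t|x].
  rewrite /nchildren count_flatten -map_comp sumnE big_map big_enum /=.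
  (* Only the block [g t] contains children of class [t]. *)
  rewrite (bigD1 t) //= big1 ?addn0 => [|t' t't].
    rewrite -g_size; apply/eqP; rewrite -all_count.
    by apply/allP => x /g_class/eqP.
  apply/eqP; rewrite eqn0Ngt -has_count -all_predC.
  by apply/allP => x /g_class /= ->.
apply/flatten_mapP/idP => [[t _]|xc].
  by rewrite g_mem mem_filter => /andP [].
by exists (class_of x); rewrite ?mem_enum // g_mem mem_filter eqxx.
Qed.

Theorem theorem1 (sg : child_sig) (F : fsm_class sg) (c : config sg)
    (c_pop : forall t : child_class sg, 0 < nchildren c t)
    (s0 : fsm_state F) (p : seq (fsm_state F))
    (loop_p : move_to_loop c s0 p) :
  exists (c' : config sg) (l : nat),
    [/\ forall t : child_class sg, nchildren c' t = #|class_states t|,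
        1 <= l <= #|fsm_state F|
      & exists q : seq (fsm_state F * config sg),
          [/\ size q = l,
              path (ktrans (kripke_of F)) (s0, c') q,
              last (s0, c') q = (s0, c')
            & [seq x.1 | x <- (s0, c') :: q] =i belast s0 p]].
Proof.
case: loop_p => p_gt0 path_p last_p.
have [c' c'_size c'_mem] := exists_eq_mem_config c_pop.
have [|q [q_size path_q last_q q_mem]] :=
    functional_closed_walk_cycle _ p_gt0 path_p last_p.
  by move=> s s1 s2; rewrite /does_move_to => /eqP -> /eqP [].
exists c', (size q); split=> //; exists [seq (s, c') | s <- q]; split.
- by rewrite size_map.
- rewrite (homo_path (e := @does_move_to sg F c)) // => s s' ss'.
  by rewrite /= eqxx /does_move_to (eq_mem_move_to c'_mem).
- by rewrite (last_map (fun s => (s, c'))) last_q.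
(* The Kripke path lists [s0] at both ends and [belast] drops the last one; the sets of states
   agree. *)
- move=> s; rewrite -q_mem /= -map_comp map_id.
  move: q_size last_q {path_q q_mem}; case/lastP: q => // q s'.
  rewrite last_rcons belast_rcons => _ ->.
  by rewrite !inE mem_rcons inE orbA orbb.
Qed.
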